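(* Let $f:I\subseteq\mathbb{R}\to\mathbb{R}$ be a differentiable mapping on $I^{\circ}$ such that $f'\in L[a,b]$, where $a,b\in I$ with $a<b$ and $\theta,\lambda\in[0,1]$. Then the following equality holds: $$(1-\theta)\bigl(\lambda f(a)+(1-\lambda)f(b)\bigr)+\theta f\bigl((1-\lambda)a+\lambda b\bigr)-\frac{1}{b-a}\int_a^b f(x)\,dx$$ $$=(b-a)\Bigl[-\lambda^2\int_0^1 (t-\theta)\,f'\bigl(ta+(1-t)[(1-\lambda)a+\lambda b]\bigr)\,dt+(1-\lambda)^2\int_0^1 (t-\theta)\,f'\bigl(tb+(1-t)[(1-\lambda)a+\lambda b]\bigr)\,dt\Bigr].$$
   Context: $I$ is an interval of real numbers and $I^{\circ}$ denotes its interior. $L[a,b]$ denotes the space of Lebesgue integrable functions on $[a,b]$.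
   Formalization: f is additionally assumed continuous on [a,b]; this is automatic if a,b lie in I°, but needed when a or b is an endpoint of I: on I=[0,1] with f(0)=1, f=0 on (0,1], θ=0, λ=1/2 the equality fails. *)

(* Defs.v *)
From HB Require Import structures.
From mathcomp Require Export all_boot all_order all_algebra.
From mathcomp Require Export all_classical all_reals all_analysis.
Export Order.TTheory GRing.Theory Num.Theory.
Export numFieldNormedType.Exports.
Global Set Implicit Arguments.
Global Unset Strict Implicit.
Global Unset Printing Implicit Defensive.

(** A function [I -> R] is represented by a total [f : R -> R] whose values
    outside [I] are irrelevant: derivability at an interior point of [I]
    depends only on [f] near that point, and if [a] or [b] is an endpoint of
    [I] then the (unspecified) value of [derive1 f] there sits on a null set. *)

(** Continuity on [[a, b]] follows from derivability on the interior of [I],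
    except at an endpoint of [I], where it has to be assumed: the indicator of
    [0] on [I = [0, 1]] violates the identity (with [theta = 0] and
    [lambda = 1/2]). *)

(* Main.v *)
Require Import Defs.
From mathcomp Require Import measurable_realfun ring lra.
Local Open Scope classical_set_scope.
Local Open Scope ring_scope.

(** Put [c = (1 - lambda) a + lambda b] and, for an endpoint [p] of [[a, b]],
    [phi t = t p + (1 - t) c]. The derivative of [t |-> (t - theta) f (phi t)]
    is [f (phi t) + (p - c) (t - theta) f' (phi t)]; integrating it over
    [[0, 1]], substituting [x = phi t] and combining [p = a] with [p = b] gives
    the identity.

    Since [f'] is only Lebesgue integrable, this needs the fundamental theorem
    of calculus for a function differentiable at every interior point with an
    integrable derivative (Rudin, Real and Complex Analysis, Theorem 7.21): a
    lower semicontinuous majorant of the derivative with nearly the same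
    integral (Vitali-Caratheodory) has an indefinite integral which dominates
    the increments of the function. Majorants are only needed for nonnegative
    functions: truncating the derivative at [- n] and adding [n x] to the
    function reduces the general case to that one. *)

(** * Semicontinuous majorants built from layers of height [d] *)

(** The bound [n%:R * d] makes the induction close: a new layer is counted only if [n%:R * d < h],
    and then the new total is at most [n%:R * d + d < h + d]. *)
Lemma sum_layers_le (R : realType) (d h : R) (n : nat) : 0 < d -> 0 <= h ->
  \sum_(k < n) d * (k%:R * d < h)%R%:R <= Num.min (n%:R * d) (h + d).
Proof.
move=> d0 h0; elim: n => [|n ih]; first by rewrite big_ord0 le_min mul0r lexx /=; lra.
rewrite big_ord_recr /=; move: ih; rewrite !le_min => /andP[ih1 ih2].
rewrite -natr1.
by case: ltP => /= ?; lra.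
Qed.

(** Every layer below [h] contributes a full [d]. Leaving [b] arbitrary above [h] allows for
    membership in open sets that enlarge the superlevel sets. *)
Lemma sum_layers_ge (R : realType) (d h : R) (n : nat) (b : nat -> bool) :
  0 < d -> (forall k, k%:R * d < h -> b k) ->
  Num.min (n%:R * d) h <= \sum_(k < n) d * (b k)%:R.
Proof.
move=> d0 hb; elim: n => [|n ih]; first by rewrite big_ord0 ge_min mul0r lexx.
rewrite big_ord_recr /=; move: ih; rewrite !ge_min -natr1.
have [hn|hn] := ltP (n%:R * d) h; first by rewrite (hb _ hn) => /= /orP[] ?; apply/orP; left; lra.
move=> ih; apply/orP; right.
have : 0 <= d * (b n)%:R by rewrite mulr_ge0// ltW.
by case/orP: ih; lra.
Qed.

(** A value below the series is already below a partial sum. That partial sum does not drop near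
    [x], because each of the finitely many open sets containing [x] contains a neighbourhood of
    [x]. *)
Lemma lower_semicontinuous_layers (R : realType) (d : R) (V : nat -> set R) :
  0 < d -> (forall n, open (V n)) ->
  lower_semicontinuous (fun x => \sum_(0 <= k <oo) (d * \1_(V k) x)%:E)%E.
Proof.
move=> d0 oV x a /= ax.
have V0 y k : (0 <= (d * \1_(V k) y)%:E)%E.
  by rewrite lee_fin mulr_ge0 ?indic_ge0// ltW.
have [n an] : exists n, (a%:E < \sum_(0 <= k < n) (d * \1_(V k) x)%:E)%E.
  apply: contrapT => /forallNP na; move: ax; apply/negP; rewrite -leNgt.
  apply: lime_le; first exact: is_cvg_nneseries.
  by apply: nearW => n; rewrite leNgt; apply/negP/na.
exists [set y | forall k, (k < n)%N -> V k x -> V k y].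
  elim: {an} n => [|n ih]; first by apply: filterS filterT => y _ k.
  have : nbhs x [set y | V n x -> V n y].
    have [Vx|nVx] := pselect (V n x); last by apply: filterS filterT => y _ /nVx.
    by apply: filterS (open_nbhs_nbhs (conj (oV n) Vx)) => y Vy _.
  move=> nVn; apply: filterS2 ih nVn => y ih yn k; rewrite ltnS leq_eqVlt.
  by move=> /predU1P[->|kn]; [exact: yn|exact: ih].
move=> y Vy; apply: (lt_le_trans an).
apply: le_trans (nneseries_lim_ge n _); last by move=> *.
rewrite !big_mkord; apply: lee_sum => k _; rewrite lee_fin ler_pM2l// !indicE.
rewrite ler_nat; case: (boolP (x \in V k)) => //; rewrite inE => /(Vy k (ltn_ord k)).
by move=> ?; rewrite mem_set.
Qed.

(* The majorant is [\sum_k d * \1_(V k)] with [V k] an open set slightly larger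
   than [[set x in D | k d < h x]]. *)
Lemma vitali_caratheodory_above (R : realType) (D : set R) (h : R -> R) (e : R) :
  let mu := @lebesgue_measure R in
  measurable D -> (mu D < +oo)%E -> measurable_fun D h ->
  (forall x, D x -> 0 <= h x) -> 0 < e ->
  exists v : R -> \bar R, [/\ lower_semicontinuous v, forall x, (0 <= v x)%E,
    forall x, D x -> ((h x)%:E <= v x)%E &
    (\int[mu]_(x in D) v x <= \int[mu]_(x in D) (h x)%:E + e%:E)%E].
Proof.
move=> mu mD muD mh h0 e0.
have muDfin : mu D \is a fin_num by rewrite ge0_fin_numE.
have m0 : 0 <= fine (mu D) by exact: fine_ge0.
(* Rounding [h] up to layers costs at most [d] at each point of [D], hence at most half of [e] in
   total; the [+ 1] covers the case of a null [D]. *)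
have [d d0 dm] : exists2 d, 0 < d & d * fine (mu D) <= e / 2.
  exists (e / 2 / (fine (mu D) + 1)); first by rewrite !divr_gt0//; lra.
  by rewrite mulrAC ler_pdivrMr ?ler_pM2l; lra.
pose E k := D `&` [set x | k%:R * d < h x].
have mE k : measurable (E k).
  rewrite /E (_ : [set x | _] = h @^-1` `]k%:R * d, +oo[); last first.
    by apply/seteqP; split=> x /=; rewrite in_itv/= andbT.
  exact: mh.
have muE k : (mu (E k) < +oo)%E.
  by apply: le_lt_trans muD; apply: le_measure; rewrite ?inE; [exact: mE|exact: mD|exact: subIsetl].
(* Weighted by the height [d], these excesses form a geometric series of sum [e / 2], the other half
   of [e]. *)
have /choice[V VP] : forall k, exists U, [/\ open U, E k `<=` U &
    (mu (U `\` E k) < (e / 2 / d / (2 ^ k.+1)%:R)%:E)%E].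
  move=> k; apply: lebesgue_regularity_outer; [exact: mE|exact: muE|].
  by rewrite !divr_gt0// ?ltr0n ?expn_gt0.
have oV k : open (V k) by have [] := VP k.
have mV k : measurable (V k) by exact: open_measurable.
have V0 (W : nat -> set R) k x : (0 <= (d * \1_(W k) x)%:E)%E.
  by rewrite lee_fin mulr_ge0 ?indic_ge0// ltW.
have layers (W : nat -> set R) : (forall k, measurable (W k)) ->
    (\int[mu]_(x in D) (\sum_(0 <= k <oo) (d * \1_(W k) x)%:E) =
     \sum_(0 <= k <oo) d%:E * mu (W k `&` D))%E.
  move=> mW; rewrite integral_nneseries//; last first.
    by move=> k; apply/measurable_EFinP/measurable_funM => //; apply: measurable_indic; exact: mW.
  apply: eq_eseriesr => k _.
  under eq_integral do rewrite EFinM.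
  rewrite ge0_integralZl_EFin ?integral_indic//; last exact: ltW.
  - exact: mW.
  - by apply/measurable_EFinP; apply: measurable_indic; exact: mW.
exists (fun x => \sum_(0 <= k <oo) (d * \1_(V k) x)%:E)%E; split.
- exact: lower_semicontinuous_layers.
- by move=> x; apply: nneseries_ge0.
- move=> x Dx.
  have [n hn] : exists n : nat, h x <= n%:R * d.
    exists (Num.truncn (h x / d)).+1.
    by rewrite -ler_pdivrMr//; apply/ltW/truncnS_gt.
  apply: le_trans (nneseries_lim_ge n _); last by move=> *.
  rewrite big_mkord sumEFin lee_fin.
  under eq_bigr do rewrite indicE.
  apply: le_trans (@sum_layers_ge _ _ (h x) n (fun k => x \in V k) d0 _).
    by rewrite le_min lexx hn.
  by move=> k kd; rewrite inE; have [_ + _] := VP k; apply; split.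
rewrite layers//.
apply: (@le_trans _ _ (\sum_(0 <= k <oo)
    (d%:E * mu (E k) + (e / 2 / (2 ^ k.+1)%:R)%:E))%E).
  apply: lee_nneseries => [k _ _|k _].
    by rewrite mule_ge0// lee_fin ltW.
  rewrite (_ : e / 2 / (2 ^ k.+1)%:R = d * (e / 2 / d / (2 ^ k.+1)%:R)); last first.
    by rewrite [RHS]mulrA; congr (_ / _); rewrite [RHS]mulrC divfK// gt_eqF.
  rewrite EFinM -muleDr//; last first.
    by rewrite ge0_adde_def// inE// lee_fin !divr_ge0// ltW.
  rewrite lee_pmul2l//.
  have [_ EV /ltW VE] := VP k.
  apply: le_trans (leeD (lexx _) VE).
  have mVE : measurable (V k `\` E k) by exact: measurableD (mV k) (mE k).
  rewrite -measureU; [|exact: mE|exact: mVE|by rewrite setDIK].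
  apply: le_measure; rewrite ?inE.
  - exact: measurableI (mV k) mD.
  - exact: measurableU (mE k) mVE.
  - by move=> x [Vx _]; have [|] := pselect (E k x); [left|right].
apply: le_trans (epsilon_trick _ _ _) _.
- by move=> k; rewrite mule_ge0// lee_fin ltW.
- by rewrite divr_ge0// ltW.
have -> : (\sum_(0 <= k <oo) d%:E * mu (E k) =
    \int[mu]_(x in D) (\sum_(0 <= k <oo) (d * \1_(E k) x)%:E))%E.
  rewrite layers//; apply: eq_eseriesr => k _.
  by rewrite (_ : _ `&` D = E k)// setIC setIA setIid.
apply: (@le_trans _ _ (\int[mu]_(x in D) ((h x)%:E + d%:E) + (e / 2)%:E)%E).
  rewrite leeD2r//; apply: ge0_le_integral => //.
  - by move=> x _; apply: nneseries_ge0.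
  - apply: ge0_emeasurable_sum => // k _; apply/measurable_EFinP/measurable_funM => //.
    apply: measurable_indic; exact: mE.
  - by apply/measurable_EFinP; apply: measurable_funD.
  - move=> x Dx; apply: lime_le; first exact: is_cvg_nneseries.
    apply: nearW => n; rewrite big_mkord sumEFin -EFinD lee_fin.
    have := sum_layers_le n d0 (h0 x Dx); rewrite le_min => /andP[_].
    apply: le_trans; apply: ler_sum => k _; rewrite ler_pM2l// indicE ler_nat.
    case: (boolP (x \in _)) => //; rewrite inE => -[_ /=]. by move=> ->.
rewrite ge0_integralD//; last 2 first.
- exact/measurable_EFinP.
- by move=> *; rewrite lee_fin ltW.
rewrite integral_cst// -addeA leeD2l//.
rewrite -[X in (_ * X)%E](fineK muDfin) -EFinM -EFinD lee_fin; lra.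
Qed.

(** * The fundamental theorem of calculus for an integrable derivative *)

(** The supremum of the points of [[a, b]] satisfying [P] satisfies [P] by the limit hypothesis, and
    the step hypothesis prevents it from being less than [b]. *)
Lemma real_induction (R : realType) (a b : R) (P : R -> Prop) : a <= b -> P a ->
  (forall s, a <= s < b -> P s -> exists2 t, s < t <= b & P t) ->
  (forall s, a < s <= b ->
    (forall e, 0 < e -> exists2 t, s - e < t <= s & a <= t /\ P t) -> P s) ->
  P b.
Proof.
move=> ab Pa step lim; pose S := [set x | a <= x <= b /\ P x].
have Sa : S a by split=> //; rewrite lexx.
have supS : has_sup S by split; [exists a|exists b => x [/andP[]]].
have aS : a <= sup S by apply: ub_le_sup => //; case: supS.
have Sb : sup S <= b by apply: ge_sup; [exists a|move=> x [/andP[]]].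
have PS : P (sup S).
  have [<-//|aneS] := eqVneq a (sup S).
  apply: lim => [|e e0]; first by rewrite lt_neqAle aneS aS.
  have [t St et] := sup_adherent e0 supS; exists t.
    by rewrite et; apply: ub_le_sup => //; case: supS.
  by case: St => /andP[].
have [<-//|Sneb] := eqVneq (sup S) b.
have [|t /andP[St tb] Pt] := step _ _ PS; first by rewrite aS lt_neqAle Sneb.
suff : t <= sup S by rewrite leNgt St.
by apply: ub_le_sup; [case: supS|split=> //; rewrite tb (le_trans aS)// ltW].
Qed.

Lemma within_continuous_dist_lt (R : realType) (A : set R) (f : R -> R) (x e : R) :
  {within A, continuous f} -> A x -> 0 < e ->
  exists2 r, 0 < r & forall y, A y -> `|x - y| < r -> `|f x - f y| < e.
Proof.
move=> /subspace_continuousP cf Ax e0.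
have /cvgrPdist_lt/(_ _ e0) := cf _ Ax.
rewrite near_withinE => /nbhs_ballP[r /= r0 rf].
by exists r => // y Ay xy; apply: rf.
Qed.

Lemma derivable_increment_lt (R : realType) (f : R -> R) (x c : R) :
  derivable f x 1 -> derive1 f x < c ->
  exists2 r, 0 < r & forall y, x < y < x + r -> f y - f x < c * (y - x).
Proof.
rewrite derive1E => df fc.
have := cvgr_lt (FF := dnbhs_filter 0) _ df _ fc.
rewrite near_withinE => /nbhs_ballP[r /= r0 rf].
exists r => // y /andP[xy yr].
have yx0 : 0 < y - x by rewrite subr_gt0.
have := rf (y - x); rewrite /ball/= sub0r normrN gtr0_norm// => /(_ _ _)/=.
rewrite [_%:A]mulr1 subrK.
rewrite -[_ *: _]/(_ * _) mulrC ltr_pdivrMr//; apply; first lra.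
by rewrite gt_eqF.
Qed.

(** Real induction on [x], comparing [F x - F a] with the integral [G x] of a semicontinuous
    majorant [v] of [h]. Just to the right of an interior point [s], [F] grows at a rate below
    [h s + k / 2] and [G] at a rate of at least [h s - k / 2]; the term [k * (x - a)] pays for the
    gap. *)
Lemma increment_le_integral_derive_bound (R : realType) (F h : R -> R) (a b : R) :
  let mu := @lebesgue_measure R in
  a < b -> {within `[a, b], continuous F} ->
  {in `]a, b[, forall x, derivable F x 1 /\ derive1 F x <= h x} ->
  measurable_fun `[a, b] h -> {in `[a, b], forall x, 0 <= h x} ->
  ((F b - F a)%:E <= \int[mu]_(x in `[a, b]) (h x)%:E)%E.
Proof.
move=> mu ab cF dF mh h0; apply/lee_addgt0Pr => e e0.
(* The budget [e] is split into [k] for the excess of the integral of [v], [k * (b - a)] for the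
   slopes and [k] for leaving [a]. *)
have [k k0 ke] : exists2 k, 0 < k & k * (b - a + 2) = e.
  exists (e / (b - a + 2)); first by rewrite divr_gt0//; lra.
  by rewrite divfK// gt_eqF//; lra.
have [|||v [lv v0 hv intv]] := @vitali_caratheodory_above R `[a, b] h k _ _ mh _ k0.
- exact: measurable_itv.
- by rewrite lebesgue_measure_itv/=; case: ifP => //; rewrite -EFinB ltry.
- by move=> x xab; exact: h0.
have mv (D : set R) : measurable_fun D v.
  by apply: measurable_funS (lower_semicontinuous_measurable lv).
pose G x := (\int[mu]_(y in `[a, x]) v y)%E.
have G0 x : (0 <= G x)%E by apply: integral_ge0.
have Gle x y : x <= y -> (G x <= G y)%E.
  move=> xy; apply: ge0_subset_integral => //; try exact: measurable_itv.
    exact: mv.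
  by apply: subset_itvl; rewrite bnd_simp.
suff : ((F b - F a)%:E <= G b + (k * (b - a) + k)%:E)%E.
  move=> /le_trans; apply; rewrite -/mu in intv.
  apply: (le_trans (leeD2r _ intv)).
  by rewrite -addeA leeD2l// -EFinD lee_fin -ke; lra.
(* The last [k] lets the induction leave [a], where [F] need not be derivable. *)
pose P x := ((F x - F a)%:E <= G x + (k * (x - a) + k)%:E)%E.
apply: (@real_induction R a b P (ltW ab)).
- by rewrite /P !subrr mulr0 add0r adde_ge0// lee_fin ltW.
- move=> s /andP[a_s sb] Ps.
  have [<-|aneqs] := eqVneq a s.
    have [|r r0 rF] := within_continuous_dist_lt cF _ k0 (x := a).
      by rewrite /= in_itv/= lexx ltW.
    pose t := Num.min b (a + r / 2).
    have at_ : a < t by rewrite lt_min ab; lra.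
    have tb : t <= b by rewrite ge_min lexx.
    have tr : t <= a + r / 2 by rewrite ge_min lexx orbT.
    exists t; first by rewrite at_ tb.
    apply: (@le_trans _ _ (0 + k%:E)%E).
      rewrite add0e lee_fin ltW//; apply: le_lt_trans (ler_norm _) _.
      rewrite distrC; apply: rF; first by rewrite /= in_itv/= tb ltW.
      by rewrite ltr0_norm; lra.
    rewrite leeD// lee_fin lerDr mulr_ge0// ?ltW//; lra.
  have {aneqs}a_s : a < s by rewrite lt_neqAle aneqs.
  have [|dFs Fhs] := dF s; first by rewrite in_itv/= a_s.
  have [|r r0 rF] := derivable_increment_lt (c := h s + k / 2) dFs; first lra.
  have [|V /nbhs_ballP[q /= q0 qV] Vv] := lv s (h s - k / 2).
    apply: lt_le_trans (hv _ _); first by rewrite lte_fin; lra.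
    by rewrite /= in_itv/= !ltW.
  pose t := Num.min b (s + Num.min r q / 2).
  have rq0 : 0 < Num.min r q by rewrite lt_min r0.
  have st : s < t by rewrite lt_min sb; lra.
  have tb : t <= b by rewrite ge_min lexx.
  have [trl tql] : t < s + r /\ t < s + q.
    have : t <= s + Num.min r q / 2 by rewrite ge_min lexx orbT.
    have : Num.min r q <= r by rewrite ge_min lexx.
    have : Num.min r q <= q by rewrite ge_min lexx orbT.
    by move=> *; split; lra.
  exists t; first by rewrite st tb.
  have Fts := rF t; rewrite st trl in Fts; have {}Fts := Fts isT.
  (* The rate [h s - k / 2] may be negative; since [v] is nonnegative, its truncation at 0 is still
     a lower bound of [v] on []s, t]]. *)
  pose c := Num.max (h s - k / 2) 0.
  have Gts : (G s + (c * (t - s))%:E <= G t)%E.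
    rewrite /G (@itv_bndbnd_setU _ _ _ (BRight s) (BRight t)); last 2 first.
    - by rewrite bnd_simp ltW.
    - by rewrite bnd_simp ltW.
    rewrite ge0_integral_setU; first 1 last.
    - exact: measurable_itv.
    - exact: measurable_itv.
    - exact: mv.
    - by move=> x _; exact: v0.
    - by apply/disj_setPS => x []/=; rewrite !in_itv/= => /andP[_ xs] /andP[+ _]; lra.
    rewrite leeD2l//.
    have -> : (c * (t - s))%:E = (\int[mu]_(x in `]s, t]) (cst c%:E) x)%E.
      rewrite integral_cst; last exact: measurable_itv.
      rewrite EFinM; congr (_ * _)%E; apply/esym/(etrans (lebesgue_measure_itv _)).
      by rewrite /= lte_fin st -EFinB.
    apply: ge0_le_integral.
    - exact: measurable_itv.
    - by move=> x _; rewrite lee_fin le_max lexx orbT.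
    - exact: measurable_cst.
    - exact: mv.
    - move=> x; rewrite /= in_itv/= => /andP[sx xt].
      rewrite /c; case: (leP (h s - k / 2) 0) => // _.
      apply/ltW/Vv/qV; rewrite /ball/= ltr0_norm; lra.
  apply: le_trans (leeD2r _ Gts).
  rewrite -addeA -EFinD.
  apply: (@le_trans _ _ ((F s - F a)%:E + ((h s + k / 2) * (t - s))%:E)%E).
    by rewrite -EFinD lee_fin; lra.
  apply: (le_trans (leeD2r _ Ps)); rewrite -addeA leeD2l// -EFinD lee_fin.
  have : (h s - k / 2) * (t - s) <= c * (t - s).
    by rewrite ler_pM2r ?subr_gt0// le_max lexx.
  lra.
- move=> s /andP[a_s sb] Pt.
  (* Limit step: continuity of [F] at [s] loses at most [e'], while the right-hand side of [P] is
     nondecreasing. *)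
  apply/lee_addgt0Pr => e' e'0.
  have [|r r0 rF] := within_continuous_dist_lt cF _ e'0 (x := s).
    by rewrite /= in_itv/= sb ltW.
  have [t /andP[srt ts] [at_ Ptt]] := Pt r r0.
  have Fst : F s - F a <= F t - F a + e'.
    rewrite lerBlDr addrAC subrK -lerBlDl ltW//.
    apply: le_lt_trans (ler_norm _) (rF _ _ _).
      by rewrite /= in_itv/= at_ (le_trans ts).
    by rewrite ger0_norm; lra.
  apply: (@le_trans _ _ ((F t - F a)%:E + e'%:E)%E).
    by rewrite -EFinD lee_fin.
  rewrite leeD2r//; apply: (le_trans Ptt).
  rewrite leeD// ?Gle// lee_fin lerD2r ler_pM2l//; lra.
Qed.

(** For each [n] the shift by [n%:R] adds [n%:R * (b - a)] to both sides of the bound and cancels.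
    The truncations are dominated by the absolute value of [f], so [n] can tend to infinity under
    the integral. *)
Lemma increment_le_integral_derive (R : realType) (F f : R -> R) (a b : R) :
  let mu := @lebesgue_measure R in
  a < b -> {within `[a, b], continuous F} ->
  {in `]a, b[, forall x : R, is_derive x 1 F (f x)} ->
  mu.-integrable `[a, b] (EFin \o f) ->
  ((F b - F a)%:E <= \int[mu]_(x in `[a, b]) (f x)%:E)%E.
Proof.
move=> mu ab cF dF intf.
have mab : measurable (`[a, b] : set (measurableTypeR R)) by exact: measurable_itv.
have /integrableP[/measurable_EFinP mf _] := intf.
pose g (n : nat) x := Num.max (f x) (- n%:R).
have mg n : measurable_fun `[a, b] (g n) by exact: measurable_maxr.
have gf n x : `|g n x| <= `|f x|.
  rewrite /g; have := ler0n R n; case: (leP (f x) (- n%:R)) => // fn n0.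
  by rewrite normrN (ger0_norm n0) (ler0_norm (x := f x)); lra.
have intg n : mu.-integrable `[a, b] (EFin \o g n).
  apply: le_integrable intf => //; first by apply/measurable_EFinP; exact: (mg n).
  by move=> x _; rewrite lee_fin gf.
have Fg n : ((F b - F a)%:E <= \int[mu]_(x in `[a, b]) (g n x)%:E)%E.
  have gn0 x : 0 <= g n x + n%:R by rewrite -lerBlDr sub0r le_max lexx orbT.
  have := @increment_le_integral_derive_bound R (fun x => F x + n%:R * x)
    (fun x => g n x + n%:R) a b ab.
  have -> : (\int[mu]_(x in `[a, b]) (g n x + n%:R)%:E =
      \int[mu]_(x in `[a, b]) (g n x)%:E + (n%:R * (b - a))%:E)%E.
    have intn : mu.-integrable `[a, b] (EFin \o cst n%:R).
      apply: continuous_compact_integrable; first exact: segment_compact.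
      by apply: continuous_subspaceT => ?; exact: cvg_cst.
    apply: (etrans (integralD mab (intg n) intn)).
    congr (_ + _)%E; apply: (etrans (integral_cst _ mab (n%:R)%:E)).
    rewrite EFinM; congr (_ * _)%E.
    by apply: (etrans (lebesgue_measure_itv _)); rewrite /= lte_fin ab -EFinB.
  have -> : ((F b + n%:R * b) - (F a + n%:R * a))%:E =
      ((F b - F a)%:E + (n%:R * (b - a))%:E)%E by rewrite -EFinD; congr EFin; ring.
  rewrite leeD2rE//; apply => //.
  - apply: within_continuousD => //; apply: continuous_subspaceT => x.
    exact: mulrl_continuous.
  - move=> x /dF dFx; have dG : is_derive x 1 (fun x => F x + n%:R * x) (f x + n%:R).
      apply: is_derive_eq (is_deriveD dFx (is_deriveZ n%:R (is_derive_id x 1))) _.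
      by rewrite [_ *: _]mulr1.
    split; first exact: (@ex_derive _ _ _ _ _ _ _ dG).
    by rewrite derive1E (@derive_val _ _ _ _ _ _ _ dG) lerD2r le_max lexx.
  - exact: measurable_funD.
have [||||| _ _ cvg_g] := @dominated_convergence _ _ R mu _ mab
  (fun n => EFin \o g n) (EFin \o f) (abse \o (EFin \o f)).
- by move=> n; apply/measurable_EFinP; exact: (mg n).
- exact/measurable_EFinP.
- apply: aeW => x _.
  apply: cvg_near_cst; apply: filterS (nbhs_infty_ger (- f x)) => n fn.
  by rewrite /= /g max_l// lerNl.
- exact: integrable_abse.
- by apply: aeW => x n _; rewrite lee_fin gf.
apply: cvge_ge cvg_g; apply: nearW => n; exact: Fg.
Qed.

(** The one-sided inequality, applied to [F] and to [- F], gives both bounds. *)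
Theorem Rintegral_derive (R : realType) (F f : R -> R) (a b : R) :
  a < b -> {within `[a, b], continuous F} ->
  {in `]a, b[, forall x : R, is_derive x 1 F (f x)} ->
  (@lebesgue_measure R).-integrable `[a, b] (EFin \o f) ->
  \int[@lebesgue_measure R]_(x in `[a, b]) f x = F b - F a.
Proof.
move=> ab cF dF intf.
have mab : measurable (`[a, b] : set (measurableTypeR R)) by exact: measurable_itv.
have intF := integrable_fin_num mab intf.
rewrite /Rintegral; apply/eqP; rewrite eq_le -!lee_fin fineK//; apply/andP; split.
  have := @increment_le_integral_derive R (- F) (- f) a b ab.
  have -> : (\int[@lebesgue_measure R]_(x in `[a, b]) ((- f) x)%:E =
      - \int[@lebesgue_measure R]_(x in `[a, b]) (f x)%:E)%E.
    by rewrite -[RHS](integralN (integrable_add_def mab intf)).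
  rewrite -opprD EFinN leeN2; apply.
  - by move=> x; apply: cvgN; exact: cF.
  - by move=> x /dF dFx; exact: is_deriveN.
  - exact: (integrableN intf).
exact: increment_le_integral_derive.
Qed.

(** * Affine change of variables *)

(* [measurableTypeR R], the carrier of [lebesgue_measure], and [R] are convertible
   but have different canonical measurable structures. *)
Definition affine (R : realType) (k c : R) : measurableTypeR R -> measurableTypeR R :=
  fun t => k * t + c.

Lemma measurable_affine (R : realType) (k c : R) : measurable_fun setT (affine k c).
Proof. by apply: measurable_funD => //; apply: measurable_funM. Qed.

(** By uniqueness of Lebesgue measure it suffices to treat half-open intervals. For negative [k] the
    preimage is closed on the left instead of the right, which does not change its length. *)
Lemma lebesgue_measure_affine (R : realType) (k c : R) (A : set (measurableTypeR R)) :
  k != 0 -> measurable A ->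
  (lebesgue_measure A = `|k|%:E * lebesgue_measure (affine k c @^-1` A))%E.
Proof.
move=> k0 mA.
have k0' : 0 <= `|k| by [].
pose pm : {measure set (measurableTypeR R) -> \bar R} :=
  pushforward (@lebesgue_measure R) (affine k c).
pose m := pm (measurable_affine k c).
rewrite (@lebesgue_measure_unique _ (mscale (NngNum k0') m))//.
move=> _ [[x y]] _ <-; rewrite /= /mscale /= /m /pm /pushforward.
have [k_gt0|k_lt0|/eqP] := ltgtP 0 k; last by rewrite eq_sym (negbTE k0).
- have -> : affine k c @^-1` `]x, y] = `](x - c) / k, (y - c) / k]%classic.
    apply/seteqP; split => t /=; rewrite /affine !in_itv/=.
      by rewrite ltr_pdivrMr// ler_pdivlMr//; lra.
    by rewrite ltr_pdivrMr// ler_pdivlMr//; lra.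
  rewrite !lebesgue_measure_itv/= !lte_fin ltr_pM2r ?invr_gt0// ltrD2r.
  by case: ifP => _; rewrite ?mule0// -!EFinB -EFinM gtr0_norm//; congr EFin; field.
- have -> : affine k c @^-1` `]x, y] = `[(y - c) / k, (x - c) / k[%classic.
    apply/seteqP; split => t /=; rewrite /affine !in_itv/=.
      by rewrite ltr_ndivlMr// ler_ndivrMr//; lra.
    by rewrite ltr_ndivlMr// ler_ndivrMr//; lra.
  rewrite !lebesgue_measure_itv/= !lte_fin ltr_nM2r ?invr_lt0// ltrD2r.
  by case: ifP => _; rewrite ?mule0// -!EFinB -EFinM ltr0_norm//; congr EFin; field.
Qed.

Lemma ge0_integral_affine (R : realType) (k c : R) (D : set (measurableTypeR R))
    (f : measurableTypeR R -> \bar R) :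
  let mu := @lebesgue_measure R in
  k != 0 -> measurable D -> measurable_fun D f -> (forall x, D x -> 0 <= f x)%E ->
  (\int[mu]_(x in D) f x =
   `|k|%:E * \int[mu]_(x in affine k c @^-1` D) f (affine k c x))%E.
Proof.
move=> mu k0 mD mf f0 /=.
have k0' : 0 <= `|k| by [].
pose pm : {measure set (measurableTypeR R) -> \bar R} :=
  pushforward (@lebesgue_measure R) (affine k c).
pose m := pm (measurable_affine k c).
rewrite (eq_measure_integral (mscale (NngNum k0') m)); last first.
  by move=> A mA _; exact: lebesgue_measure_affine.
rewrite ge0_integral_mscale//; congr (_ * _)%E.
by rewrite ge0_integral_pushforward// => [|x]; [exact: measurable_affine|rewrite inE; exact: f0].
Qed.

Lemma integrable_affine (R : realType) (k c : R) (D : set (measurableTypeR R))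
    (f : R -> R) :
  k != 0 -> measurable D -> (@lebesgue_measure R).-integrable D (EFin \o f) ->
  (@lebesgue_measure R).-integrable (affine k c @^-1` D)
    (EFin \o (f \o affine k c)).
Proof.
move=> k0 mD /integrableP[mf fD].
have mphiD : measurable (affine k c @^-1` D).
  by rewrite -[X in measurable X]setTI; exact: measurable_affine.
apply/integrableP; split.
  apply: (measurable_comp mD _ mf); first by move=> _ [t /= Dt <-].
  exact: measurable_funTS (measurable_affine k c).
move: fD; rewrite (ge0_integral_affine c k0 mD); last 2 first.
- exact: measurableT_comp.
- by move=> x _; exact: abse_ge0.
(* An infinite integral of the composite would stay infinite after multiplication by the positive
   number [|k|]. *)
rewrite !ltey; apply: contra => /eqP ->.
by rewrite mulry gtr0_sg ?mul1e// normr_gt0.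
Qed.

Lemma Rintegral_affine (R : realType) (k c : R) (D : set (measurableTypeR R))
    (f : R -> R) :
  let mu := @lebesgue_measure R in
  k != 0 -> measurable D -> mu.-integrable D (EFin \o f) ->
  \int[mu]_(x in D) f x = `|k| * \int[mu]_(x in affine k c @^-1` D) f (affine k c x).
Proof.
move=> mu k0 mD intf; have /integrableP[mf _] := intf.
have intfa := integrable_affine c k0 mD intf.
have mphiD : measurable (affine k c @^-1` D).
  by rewrite -[X in measurable X]setTI; exact: measurable_affine.
(* The nonnegative case handles the positive and negative parts separately; both integrals are
   finite, so [|k|] factors out of their difference. *)
rewrite /Rintegral integralE [in RHS]integralE.
rewrite (ge0_integral_affine c k0 mD (measurable_funepos mf)); last first.
  by move=> x _; exact: funepos_ge0.
rewrite (ge0_integral_affine c k0 mD (measurable_funeneg mf)); last first.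
  by move=> x _; exact: funeneg_ge0.
have posE : (\int[mu]_(x in affine k c @^-1` D) (EFin \o f)^\+ (affine k c x) =
    \int[mu]_(x in affine k c @^-1` D) (EFin \o (f \o affine k c))^\+ x)%E.
  by apply: eq_integral => x _; rewrite !funeposE.
have negE : (\int[mu]_(x in affine k c @^-1` D) (EFin \o f)^\- (affine k c x) =
    \int[mu]_(x in affine k c @^-1` D) (EFin \o (f \o affine k c))^\- x)%E.
  by apply: eq_integral => x _; rewrite !funenegE.
have pfin := integrable_pos_fin_num mphiD intfa.
have nfin := integrable_neg_fin_num mphiD intfa.
rewrite posE negE -muleBr//; last exact: fin_num_adde_defr pfin.
by rewrite fineM// fin_numB pfin.
Qed.

(** * Integration by parts on the segment between an endpoint and [c] *)

(** The map sends 0 to [c] and 1 to [p]. Using [Num.min] and [Num.max] treats [p < c] and [p > c]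
    together, as required for [p = a] and [p = b]. *)
Lemma affine_preimage_segment (R : realType) (p c : R) : p != c ->
  affine (p - c) c @^-1` `[Num.min p c, Num.max p c] = `[0, 1]%classic.
Proof.
move=> pc; apply/seteqP; split=> t /=; rewrite /affine !in_itv/=.
  by case: (ltgtP p c) pc => // pc _ /andP[l r]; apply/andP; split; nra.
by case: (ltgtP p c) pc => // pc _ /andP[l r]; apply/andP; split; nra.
Qed.

Lemma affine_in_segment_interior (R : realType) (p c t : R) : p != c ->
  t \in `]0, 1[ -> affine (p - c) c t \in `]Num.min p c, Num.max p c[.
Proof.
rewrite /affine !in_itv/= => pc.
by case: (ltgtP p c) pc => // pc _ /andP[l r]; apply/andP; split; nra.
Qed.

(** Integration by parts with the weight [t - w]: the boundary values of [(t - w) * f (phi t)] are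
    [(1 - w) * f p] at 1 and [- w * f c] at 0. *)
Lemma Rintegral_weighted_derive_segment (R : realType) (f : R -> R) (p c w : R) :
  let mu := @lebesgue_measure R in
  let D := `[Num.min p c, Num.max p c] : interval R in
  p != c -> {within [set` D], continuous f} ->
  {in `]Num.min p c, Num.max p c[, forall x : R, derivable f x 1} ->
  mu.-integrable [set` D] (EFin \o derive1 f) ->
  (c - p) * \int[mu]_(t in `[0, 1]) ((t - w) * derive1 f (t * p + (1 - t) * c)) =
  `|p - c|^-1 * \int[mu]_(x in [set` D]) f x - (1 - w) * f p - w * f c.
Proof.
move=> mu D pc cf df intf'.
have k0 : p - c != 0 by rewrite subr_eq0.
pose phi := affine (p - c) c.
have phiE t : t * p + (1 - t) * c = phi t by rewrite /phi /affine; ring.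
have mD : measurable ([set` D] : set (measurableTypeR R)) by exact: measurable_itv.
have m01 : measurable (`[0, 1] : set (measurableTypeR R)) by exact: measurable_itv.
have preD : phi @^-1` [set` D] = `[0, 1]%classic by exact: affine_preimage_segment.
have cphi : continuous (phi : R -> R).
  move=> t; apply: cvgD; last exact: cvg_cst.
  exact: mulrl_continuous.
have cfphi : {within `[0, 1], continuous (f \o phi : R -> R)}.
  apply/subspace_continuousP => t t01.
  have Dt : [set` D] (phi t) by move: t01; rewrite -preD.
  have /subspace_continuousP/(_ _ Dt) cft := cf.
  apply: cvg_comp cft => V VD.
  have phiVD : nbhs t [set s | [set` D] (phi s) -> V (phi s)] := cphi t _ VD.
  suff : nbhs t [set s | `[0, 1]%classic s -> V (phi s)] by [].
  apply: filterS phiVD => s DV s01; apply: DV.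
  by move: s01; rewrite -preD.
have intf : mu.-integrable [set` D] (EFin \o f).
  by apply: continuous_compact_integrable => //; exact: segment_compact.
have intfphi : mu.-integrable `[0, 1] (EFin \o (f \o phi)).
  by rewrite -preD; exact: integrable_affine.
have intf'phi : mu.-integrable `[0, 1] (EFin \o (derive1 f \o phi)).
  by rewrite -preD; exact: integrable_affine.
have cw : {within `[0, 1], continuous (fun t : R => t - w)}.
  by apply: continuous_subspaceT => t; apply: cvgB; [exact: cvg_id|exact: cvg_cst].
have intwf' : mu.-integrable `[0, 1] (EFin \o (fun t => (t - w) * derive1 f (phi t))).
  apply: (integrableMr m01 (h := fun t => t - w) _ _ intf'phi).
    by apply: measurable_funB => //; exact: measurable_cst.
  have /compact_bounded[M [_ wM]] := continuous_compact cw (@segment_compact R 0 1).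
  by exists M; split; rewrite ?num_real// => r Mr t t01; apply: (wM r Mr); exists t.
have -> : \int[mu]_(x in [set` D]) f x =
    `|p - c| * \int[mu]_(t in `[0, 1]) f (phi t).
  by rewrite -preD; exact: Rintegral_affine.
under eq_Rintegral do rewrite phiE.
have := @Rintegral_derive R (fun t => (t - w) * f (phi t))
  (fun t => f (phi t) + (p - c) * ((t - w) * derive1 f (phi t))) 0 1 ltr01.
have phi0 : phi 0 = c by rewrite /phi /affine; ring.
have phi1 : phi 1 = p by rewrite /phi /affine; ring.
rewrite phi0 phi1.
have intkwf' : mu.-integrable `[0, 1]
    (EFin \o (fun t => (p - c) * ((t - w) * derive1 f (phi t)))).
  exact: (integrableZl m01 (p - c) intwf').
rewrite (RintegralD m01 intfphi intkwf') (RintegralZl _ m01 intwf').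
rewrite mulKf ?normr_eq0// => FTC.
suff -> : \int[mu]_(t in `[0, 1]) f (phi t) = (1 - w) * f p + w * f c
    - (p - c) * \int[mu]_(t in `[0, 1]) ((t - w) * derive1 f (phi t)) by ring.
apply/eqP; rewrite eq_sym subr_eq eq_sym; apply/eqP; rewrite FTC.
- by ring.
- by move=> t; apply: cvgM; [exact: cw|exact: cfphi].
- move=> t t01.
  have dfphi := df _ (affine_in_segment_interior pc t01).
  have dphi : is_derive (t : R) 1 (phi : R -> R) (p - c).
    have dZ := is_deriveZ (p - c) (is_derive_id t 1).
    by apply: is_derive_eq (is_deriveD dZ (is_derive_cst c t 1)) _; rewrite addr0 [LHS]mulr1.
  have dw : is_derive (t : R) 1 (fun t : R => t - w) 1.
    by apply: is_derive_eq (is_deriveB (is_derive_id t 1) (is_derive_cst w t 1)) _; rewrite subr0.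
  have df_phi : is_derive (phi t) 1 f (derive1 f (phi t)).
    by rewrite derive1E; exact: derivableP.
  apply: is_derive_eq (is_deriveM dw (is_derive1_comp df_phi dphi)) _.
  by rewrite /= -![_ *: _]/(_ * _); ring.
- exact: (integrableD m01 intfphi intkwf').
Qed.

(** * Combination of the segments [[a, c]] and [[c, b]] *)

Theorem lemma1 (R : realType) (I : set R) (hI : is_interval I) (f : R -> R)
    (hdiff : forall x : R, I° x -> derivable f x 1)
    (a b : R) (ha : I a) (hb : I b) (hab : a < b)
    (hcont : {within `[a, b], continuous f})
    (hint : (@lebesgue_measure R).-integrable `[a, b] (EFin \o derive1 f))
    (theta lambda : R)
    (htheta : 0 <= theta <= 1) (hlambda : 0 <= lambda <= 1) :
  (1 - theta) * (lambda * f a + (1 - lambda) * f b)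
    + theta * f ((1 - lambda) * a + lambda * b)
    - (b - a)^-1 * \int[@lebesgue_measure R]_(x in `[a, b]) f x
  = (b - a) *
    (- lambda ^+ 2 *
       (\int[@lebesgue_measure R]_(t in `[0, 1])
          ((t - theta) *
           derive1 f (t * a + (1 - t) * ((1 - lambda) * a + lambda * b))))
     + (1 - lambda) ^+ 2 *
       (\int[@lebesgue_measure R]_(t in `[0, 1])
          ((t - theta) *
           derive1 f (t * b + (1 - t) * ((1 - lambda) * a + lambda * b))))).
Proof.
set c := (1 - lambda) * a + lambda * b.
set mu := @lebesgue_measure R.
have /andP[l0 l1] := hlambda.
have ac : a <= c by rewrite /c; nra.
have cb : c <= b by rewrite /c; nra.
have df : {in `]a, b[, forall x : R, derivable f x 1}.
  move=> x xab; apply: hdiff; rewrite /interior.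
  apply: filterS (near_in_itvoo xab) => y; rewrite in_itv/= => /andP[ay yb].
  by apply: (hI a b) => //; rewrite !ltW.
have intf : mu.-integrable `[a, b] (EFin \o f).
  by apply: continuous_compact_integrable => //; exact: segment_compact.
have segment p : a <= p <= b -> p != c ->
    (c - p) * \int[mu]_(t in `[0, 1])
      ((t - theta) * derive1 f (t * p + (1 - t) * c)) =
    `|p - c|^-1 * \int[mu]_(x in `[Num.min p c, Num.max p c]) f x
      - (1 - theta) * f p - theta * f c.
  move=> /andP[ap pb] pc.
  have am : a <= Num.min p c by rewrite le_min ap.
  have Mb : Num.max p c <= b by rewrite ge_max pb.
  have sub : `[Num.min p c, Num.max p c] `<=` `[a, b].
    by apply: subset_itv; rewrite bnd_simp.
  apply: Rintegral_weighted_derive_segment => //.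
  - exact: continuous_subspaceW hcont.
  - move=> x; rewrite in_itv/= => /andP[mx xM]; apply: df.
    by rewrite in_itv/= (le_lt_trans am)//= (lt_le_trans xM).
  - apply: integrableS hint => //; exact: measurable_itv.
(* The segment identity for [p = a], multiplied by [- lambda]: since [c - a = lambda * (b - a)],
   this turns the mean over [[a, c]] into an integral divided by [b - a]. *)
have left : - ((b - a) * lambda ^+ 2) * \int[mu]_(t in `[0, 1])
      ((t - theta) * derive1 f (t * a + (1 - t) * c)) =
    lambda * ((1 - theta) * f a + theta * f c)
      - (b - a)^-1 * \int[mu]_(x in `[a, c]) f x.
  (* If [lambda = 0] the segment degenerates to a point and both sides vanish. *)
  have [l_eq0|l_neq0] := eqVneq lambda 0.
    have -> : c = a by rewrite /c l_eq0; ring.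
    by rewrite set_itv1 Rintegral_set1 l_eq0; ring.
  have ca : c - a = lambda * (b - a) by rewrite /c; ring.
  have ltac : a < c by rewrite -subr_gt0 ca mulr_gt0 ?subr_gt0// lt_neqAle eq_sym l_neq0.
  have := segment a; rewrite lexx ltW// lt_eqF// min_l// max_r// => /(_ isT isT).
  rewrite distrC gtr0_norm ?subr_gt0// ca => E.
  transitivity (- lambda * (lambda * (b - a) * \int[mu]_(t in `[0, 1])
      ((t - theta) * derive1 f (t * a + (1 - t) * c)))); first by ring.
  by rewrite E; field; rewrite l_neq0 subr_eq0 gt_eqF.
(* Likewise for [p = b], with the factor [- (1 - lambda)], because [c - b] is negative when [lambda]
   is not 1. *)
have right : ((b - a) * (1 - lambda) ^+ 2) * \int[mu]_(t in `[0, 1])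
      ((t - theta) * derive1 f (t * b + (1 - t) * c)) =
    (1 - lambda) * ((1 - theta) * f b + theta * f c)
      - (b - a)^-1 * \int[mu]_(x in `[c, b]) f x.
  have [l_eq1|l_neq1] := eqVneq (1 - lambda) 0.
    have -> : c = b by rewrite /c (_ : lambda = 1); [ring|lra].
    by rewrite set_itv1 Rintegral_set1 l_eq1; ring.
  have bc : b - c = (1 - lambda) * (b - a) by rewrite /c; ring.
  have ltcb : c < b.
    by rewrite -subr_gt0 bc mulr_gt0 ?subr_gt0// -subr_gt0 lt_neqAle eq_sym l_neq1 subr_ge0.
  have := segment b; rewrite lexx ltW// gt_eqF// min_r// max_l// => /(_ isT isT).
  rewrite gtr0_norm ?subr_gt0// bc => E.
  transitivity (- (1 - lambda) * ((c - b) * \int[mu]_(t in `[0, 1])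
      ((t - theta) * derive1 f (t * b + (1 - t) * c)))).
    by rewrite -[c - b]opprB bc; ring.
  by rewrite E; field; rewrite l_neq1 subr_eq0 gt_eqF.
have -> : \int[mu]_(x in `[a, b]) f x =
    \int[mu]_(x in `[a, c]) f x + \int[mu]_(x in `[c, b]) f x.
  have intcb : mu.-integrable `]c, b] (EFin \o f).
    apply: integrableS intf => //.
    by apply: subset_itv; rewrite bnd_simp.
  rewrite -[X in _ = _ + X]Rintegral_itv_obnd_cbnd//.
  by rewrite -(@Rintegral_itvB _ _ (BLeft a) (BRight b) c)// addrC subrK.
(* The two multiples of [theta * f c] have weights [lambda] and [1 - lambda], which add up to 1. *)
rewrite [RHS]mulrDr 2![(b - a) * (_ * _)]mulrA mulrN right left; ring.
Qed.
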